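(* Consider the stochastic approximation process with expanding projections $(\theta_i,X_i)_{i\ge 0}$ described in the context. Assume that the Lyapunov condition (W) stated in the context holds, and that for any $(\theta,x)\in\mathcal{R}_0\times\mathsf{X}$ the following three noise conditions hold: (N1) $\mathbb{P}_{\theta,x}\bigl(\lim_{i\to\infty}\Gamma_{i+1}\,|\nabla w(\theta_i)|\cdot|H(\theta_i,X_{i+1})|=0\bigr)=1$; (N2) $\mathbb{E}_{\theta,x}\bigl[\sum_{i=0}^\infty\Gamma_{i+1}^2|H(\theta_i,X_{i+1})|^2\bigr]<\infty$; (N3) $\mathbb{E}_{\theta,x}\bigl[\sup_{k\ge 0}\bigl|\sum_{i=0}^k\Gamma_{i+1}\langle\nabla w(\theta_i),\bar H(\theta_i,X_{i+1})\rangle\bigr|\bigr]<\infty$. Then, for any $(\theta,x)\in\mathcal{R}_0\times\mathsf{X}$, $$\mathbb{P}_{\theta,x}\Bigl(\limsup_{i\to\infty}w(\theta_i)<\infty\Bigr)=1 .$$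
   Context: Setting. Let $\Theta\subset\mathbb{R}^d$ and let $(\mathsf{X},\mathcal{B}(\mathsf{X}))$ be a measurable space. Let $\{P_\theta\}_{\theta\in\Theta}$ be a family of Markov transition probabilities on $\mathsf{X}$ with stationary distributions $\{\pi_\theta\}_{\theta\in\Theta}$, respectively, and let $H:\Theta\times\mathsf{X}\to\mathbb{R}^d$ be measurable. Put $h(\theta):=\int_{\mathsf{X}}H(\theta,x)\,\pi_\theta(\mathrm{d}x)$ and $\bar H(\theta,x):=H(\theta,x)-h(\theta)$. $\langle\cdot,\cdot\rangle$ and $|\cdot|$ denote the standard inner product and norm on $\mathbb{R}^d$. Process. Let $\{\mathcal{R}_i\}_{i\ge0}$ be subsets of $\Theta$ and let the step sizes $(\Gamma_i)_{i\ge1}$ be nonnegative random variables. For a starting point $(\theta_0,X_0)\equiv(\theta,x)\in\mathcal{R}_0\times\mathsf{X}$ and recursively for $i\ge0$: $X_{i+1}\mid\mathcal{F}_i\sim P_{\theta_i}(X_i,\cdot)$; $\theta_{i+1}^*=\theta_i+\Gamma_{i+1}H(\theta_i,X_{i+1})$; $\theta_{i+1}=\theta_{i+1}^*\mathbb{I}\{\theta_{i+1}^*\in\mathcal{R}_{i+1}\}+\theta_{i+1}^{\mathrm{proj}}\mathbb{I}\{\theta_{i+1}^*\notin\mathcal{R}_{i+1}\}$, where $\mathcal{F}_i$ is the $\sigma$-algebra generated by $\theta_0,X_0,\theta_1,X_1,\Gamma_1,\ldots,\theta_i,X_i,\Gamma_i$, and $\theta_{i+1}^{\mathrm{proj}}$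 is a $\sigma(\mathcal{F}_i,X_{i+1},\theta_{i+1}^* )$-measurable random variable taking values in $\mathcal{R}_{i+1}$. $\mathbb{P}_{\theta,x}$ and $\mathbb{E}_{\theta,x}$ denote the law of this process started at $(\theta,x)$ and the corresponding expectation. For $M>0$, $\mathcal{W}_M:=\{\theta\in\Theta: w(\theta)\le M\}$, and $A^c$ denotes complement. Condition (W). There exists a twice continuously differentiable function $w:\Theta\to[0,\infty)$ such that (i) the Hessian matrix $\mathrm{Hess}_w:\Theta\to\mathbb{R}^{d\times d}$ is bounded: $C_w:=\sup_{\theta\in\Theta}\sup_{|\theta_0|=1}|\mathrm{Hess}_w(\theta)\theta_0|<\infty$; (ii) the projection sets are increasing subsets of $\Theta$, that is, $\mathcal{R}_i\subset\mathcal{R}_{i+1}$ for all $i\ge0$, and $\hat\Theta:=\bigcup_{i=0}^\infty\mathcal{R}_i\subset\Theta$; (iii) there is a constant $M_0>0$ such that $\langle\nabla w(\theta),h(\theta)\rangle\le0$ for any $\theta\in\mathcal{W}_{M_0}^c\cap\hat\Theta$; (iv) for all $i\ge1$, whenever $\theta_i^*\notin\mathcal{R}_i$, one has $\theta_i^{\mathrm{proj}}\in\mathcal{R}_i$ and $w(\theta_i^{\mathrm{proj}})\le w(\theta_i^* )$, $\mathbb{P}_{\theta,x}$-a.s.; (v) there are constants $\alpha_w,c\in[0,\infty)$ and a non-decreasing sequence of constants $\xi_i\in[1,\infty)$ with $\sup_{\theta\in\mathcal{R}_i}|\nabla w(\theta)|\le c\,\xi_i^{\alpha_w}$ for all $i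\ge0$.
   Formalization: The formal theorem additionally assumes that almost surely, for every i, the segment from θ_i to θ*_{i+1} lies in Θ (automatic if Θ is convex and θ*_{i+1} ∈ Θ); for arbitrary, e.g. disconnected, Θ the statement is false. *)

(* Defs.v *)
From HB Require Import structures.
From mathcomp Require Export all_boot all_order all_algebra.
From mathcomp Require Export all_classical all_reals all_analysis.
From mathcomp Require Export measurable_realfun.

Set Implicit Arguments.
Unset Strict Implicit.
Unset Printing Implicit Defensive.

Import Order.TTheory GRing.Theory Num.Theory.
Import numFieldNormedType.Exports.

Local Open Scope classical_set_scope.
Local Open Scope ring_scope.

Section euclidean.
Context {R : realType} {d : nat}.
Implicit Types (u v : 'rV[R]_d) (w : 'rV[R]_d -> R).

Definition dot u v : R := \sum_(j < d) u 0 j * v 0 j.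

(* The library norm on ['rV[R]_d] is the sup norm. *)
Definition enorm u : R := Num.sqrt (dot u u).

Definition unitvec (j : 'I_d) : 'rV[R]_d := delta_mx 0 j.

Definition grad w (t : 'rV[R]_d) : 'rV[R]_d := \row_j 'D_(unitvec j) w t.

Definition hess w (t : 'rV[R]_d) : 'M[R]_d :=
  \matrix_(j, k) 'D_(unitvec j) ('D_(unitvec k) w) t.

(* [w] is C^2 on an arbitrary set [T] when it is C^2 on some open set
   containing [T]; for open [T] this is the usual notion. *)
Definition C2_on (T : set 'rV[R]_d) w : Prop :=
  exists U : set 'rV[R]_d, [/\ open U, T `<=` U &
    forall t, U t -> [/\ differentiable w t,
                         differentiable (grad w) t &
                         {for t, continuous (hess w)}]].

End euclidean.

Definition borel_rV (R : realType) (d : nat) :=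
  g_sigma_algebraType (@open 'rV[R]_d).

(* Measurability on [D] for the trace sigma-algebra.  Unlike
   [measurable_fun D f], this is not vacuous when [D] is not measurable. *)
Definition trace_measurable d1 d2 (T1 : measurableType d1)
    (T2 : measurableType d2) (D : set T1) (f : T1 -> T2) : Prop :=
  forall B, measurable B ->
    exists2 A, measurable A & D `&` f @^-1` B = D `&` A.

(* [f] is measurable for the sub-sigma-algebra [F]. *)
Definition sub_measurable (O : Type) d2 (T2 : measurableType d2)
    (F : set (set O)) (f : O -> T2) : Prop :=
  preimage_set_system setT f measurable `<=` F.

Section model.
Context {R : realType} {d : nat} {dX : measure_display} {X : measurableType dX}.
Variables (Theta : set 'rV[R]_d) (P : 'rV[R]_d -> R.-pker X ~> X)
  (pi : 'rV[R]_d -> probability X R) (H : 'rV[R]_d -> X -> 'rV[R]_d).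

Definition stationary : Prop :=
  forall t, Theta t -> forall A : set X, measurable A ->
    (\int[pi t]_y P t y A = pi t A)%E.

Definition H_measurable : Prop :=
  trace_measurable (T1 := (borel_rV R d * X)%type) (T2 := borel_rV R d)
    [set z | Theta z.1] (fun z => H z.1 z.2).

(* The integrals defining the mean field exist. *)
Definition H_integrable : Prop :=
  forall t, Theta t -> forall j : 'I_d,
    (pi t).-integrable setT (fun y => (H t y 0 j)%:E).

Definition mean_field (t : 'rV[R]_d) : 'rV[R]_d :=
  \row_j (\int[pi t]_y H t y 0 j)%R.

Definition H_bar (t : 'rV[R]_d) (y : X) : 'rV[R]_d := H t y - mean_field t.

Section process.
Context {dO : measure_display} {O : measurableType dO}.
Variables (Pr : probability O R) (Rs : nat -> set 'rV[R]_d).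
(* [Gam 0], [ths 0] and [thp 0] are never used. *)
Variables (Xp : nat -> O -> X) (Gam : nat -> O -> R)
  (th ths thp : nat -> O -> 'rV[R]_d).

Definition history (i : nat) : set (set O) :=
  <<s [set B | exists2 j, (j <= i)%N &
        [\/ preimage_set_system setT (th j : O -> borel_rV R d) measurable B,
            preimage_set_system setT (Xp j) measurable B |
            (1 <= j)%N /\ preimage_set_system setT (Gam j) measurable B]] >>.

(* sigma(F_i, X_{i+1}, theta*_{i+1}) *)
Definition history_proj (i : nat) : set (set O) :=
  <<s history i
      `|` preimage_set_system setT (Xp i.+1) measurable
      `|` preimage_set_system setT (ths i.+1 : O -> borel_rV R d) measurable >>.

Record sa_process (t0 : 'rV[R]_d) (x0 : X) : Prop := {
  sa_th_meas : forall i, measurable_fun setT (th i : O -> borel_rV R d);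
  sa_X_meas : forall i, measurable_fun setT (Xp i);
  sa_Gam_meas : forall i, measurable_fun setT (Gam i.+1);
  sa_Gam_ge0 : forall i o, 0 <= Gam i.+1 o;
  sa_th0 : forall o, th 0 o = t0;
  sa_X0 : forall o, Xp 0 o = x0;
  (* X_{i+1} | F_i ~ P_{theta_i}(X_i, .): the transition probability is a
     version of the conditional probability given F_i *)
  sa_cond_meas : forall i (A : set X), measurable A ->
    sub_measurable (history i) ((fun o => P (th i o) (Xp i o) A) : O -> \bar R);
  sa_cond_law : forall i (A : set X) (B : set O), measurable A -> history i B ->
    (\int[Pr]_(o in B) P (th i o) (Xp i o) A = Pr (B `&` Xp i.+1 @^-1` A))%E;
  sa_ths : forall i o,
    ths i.+1 o = th i o + Gam i.+1 o *: H (th i o) (Xp i.+1 o);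
  sa_th : forall i o,
    th i.+1 o = if ths i.+1 o \in Rs i.+1 then ths i.+1 o else thp i.+1 o;
  sa_thp_meas : forall i,
    sub_measurable (T2 := borel_rV R d) (history_proj i) (thp i.+1);
  sa_thp_in : forall i o, Rs i.+1 (thp i.+1 o)
}.

(* The increment from theta_i to theta*_{i+1} stays in [Theta], which is
   automatic when [Theta] is convex and theta*_{i+1} is in [Theta]. In
   particular w(theta*_{i+1}) only involves [w] on [Theta]. *)
Definition moves_within : Prop :=
  forall i, {ae Pr, forall o, forall s : R, 0 <= s <= 1 ->
    Theta (th i o + s *: (ths i.+1 o - th i o))}.

Variable w : 'rV[R]_d -> R.

Definition noise1 : Prop :=
  Pr [set o | (fun i => Gam i.+1 o * enorm (grad w (th i o))
                        * enorm (H (th i o) (Xp i.+1 o))) @ \oo --> (0 : R)]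
  = 1%E.

(* Finiteness of the expectation of a nonnegative extended random variable is
   rendered as integrability, which includes its measurability. *)
Definition noise2 : Prop :=
  Pr.-integrable setT (fun o =>
    \sum_(0 <= i <oo)
      (Gam i.+1 o ^+ 2 * enorm (H (th i o) (Xp i.+1 o)) ^+ 2)%:E)%E.

Definition noise3 : Prop :=
  Pr.-integrable setT (fun o =>
    ereal_sup (range (fun k : nat =>
      (`| \sum_(0 <= i < k.+1)
            Gam i.+1 o * dot (grad w (th i o)) (H_bar (th i o) (Xp i.+1 o)) |
      )%:E))).

End process.

Definition sublevel (w : 'rV[R]_d -> R) (M : R) : set 'rV[R]_d :=
  [set t | Theta t /\ w t <= M].

Section lyapunov.
Context {dO : measure_display} {O : measurableType dO}.
Variables (Pr : 'rV[R]_d -> X -> probability O R) (Rs : nat -> set 'rV[R]_d)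
  (ths thp : 'rV[R]_d -> X -> nat -> O -> 'rV[R]_d) (w : 'rV[R]_d -> R).

Record lyapunov : Prop := {
  lyap_ge0 : forall t, Theta t -> 0 <= w t;
  lyap_C2 : C2_on Theta w;
  lyap_hess : exists Cw : R, forall t u, Theta t -> enorm u = 1 ->
    enorm (hess w t *m u^T)^T <= Cw;
  lyap_incr : forall i, Rs i `<=` Rs i.+1;
  lyap_sub : \bigcup_i Rs i `<=` Theta;
  lyap_drift : exists2 M0 : R, 0 < M0 &
    forall t, (~` sublevel w M0 `&` \bigcup_i Rs i) t ->
      dot (grad w t) (mean_field t) <= 0;
  lyap_proj : forall t0 x0, Rs 0%N t0 ->
    {ae Pr t0 x0, forall o, forall i, (1 <= i)%N ->
      ~ Rs i (ths t0 x0 i o) ->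
      Rs i (thp t0 x0 i o) /\ w (thp t0 x0 i o) <= w (ths t0 x0 i o)};
  lyap_grad : exists (alpha c : R) (xi : nat -> R),
    [/\ 0 <= alpha, 0 <= c, forall i, 1 <= xi i,
        {homo xi : i j / (i <= j)%N >-> i <= j} &
        forall i t, Rs i t -> enorm (grad w t) <= c * xi i `^ alpha]
}.

End lyapunov.
End model.

(* Main.v *)
Require Import Defs.
From mathcomp Require Import lra.
Import Order.TTheory GRing.Theory Num.Theory.
Import numFieldNormedType.Exports.
Local Open Scope classical_set_scope.
Local Open Scope ring_scope.

(** The argument is deterministic along almost every path.

    Since the segment from theta_i to theta*_{i+1} stays in Theta, where the
    Hessian of w is bounded, Taylor's formula to second order ([descent_lemma])
    and the fact that the projection does not increase w give
      w(theta_{i+1}) <= w(theta_i) + Gamma <grad w(theta_i), H>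
                        + C Gamma^2 |H|^2.
    While w(theta_i) > M0, splitting H into its mean h and the fluctuation
    H - h, the drift condition discards the term <grad w, h>, so that w grows
    at most by the increments of two series with bounded partial sums: the
    noise series of [noise3] and the square series of [noise2].  When
    w(theta_i) <= M0, Cauchy-Schwarz shows that one step overshoots M0 by at
    most Gamma |grad w| |H| + C Gamma^2 |H|^2, which is bounded in i by
    [noise1] and [noise2].  Hence every excursion above the level M0 starts
    from a bounded height and gains a bounded amount; [drift_bounded] turns
    this into a uniform bound on w(theta_i).

    The probabilistic content is that the good paths have probability one.
    A probability evaluated at a set says something about almost every path
    only if the set is measurable, so the convergence event of [noise1] and the
    event of the conclusion have to be shown measurable.  This rests on
    theta_i lying in Theta for every i, on the continuity of w and grad w on an
    open set containing Theta, and on the measurability of H on Theta x X. *)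

Set Implicit Arguments.
Unset Strict Implicit.
Unset Printing Implicit Defensive.

(** * Euclidean inner product and norm *)

Section euclidean_space.
Context {R : realType} {d : nat}.
Implicit Types (u v t : 'rV[R]_d) (a : R).

Lemma dotC u v : dot u v = dot v u.
Proof. by apply: eq_bigr => j _; rewrite mulrC. Qed.

Lemma dotDr u v v' : dot u (v + v') = dot u v + dot u v'.
Proof. by rewrite -big_split; apply: eq_bigr => j _; rewrite mxE mulrDr. Qed.

Lemma dotZr u a v : dot u (a *: v) = a * dot u v.
Proof. by rewrite mulr_sumr; apply: eq_bigr => j _; rewrite mxE mulrCA. Qed.

Lemma dot_ge0 u : 0 <= dot u u.
Proof. by apply: sumr_ge0 => j _; rewrite -expr2 sqr_ge0. Qed.

Lemma enorm_ge0 u : 0 <= enorm u. Proof. exact: sqrtr_ge0. Qed.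

Lemma enorm_sqr u : enorm u ^+ 2 = dot u u.
Proof. by rewrite sqr_sqrtr// dot_ge0. Qed.

Lemma enormZ a u : enorm (a *: u) = `|a| * enorm u.
Proof.
rewrite /enorm dotZr dotC dotZr mulrA -expr2 sqrtrM ?sqr_ge0//.
by rewrite sqrtr_sqr.
Qed.

Lemma enorm0 : enorm (0 : 'rV[R]_d) = 0.
Proof. by rewrite -(scale0r (0 : 'rV[R]_d)) enormZ normr0 mul0r. Qed.

Lemma enorm_eq0 u : enorm u = 0 -> u = 0.
Proof.
move=> u0; have := enorm_sqr u; rewrite u0 expr0n /= => /esym/eqP.
rewrite psumr_eq0 => [|j _]; last by rewrite -expr2 sqr_ge0.
move=> /allP h; apply/rowP => j; rewrite mxE; apply/eqP.
by have := h j (mem_index_enum j); rewrite mulf_eq0 orbb.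
Qed.

(** Cauchy-Schwarz: expand the squared norm of |v| u - |u| v, which is
    2 |u| |v| (|u| |v| - <u, v>). *)
Lemma dot_le_enorm u v : dot u v <= enorm u * enorm v.
Proof.
have [/enorm_eq0 ->|u0] := eqVneq (enorm u) 0.
  by rewrite dotC -(scale0r 0) dotZr mul0r mulr_ge0 ?enorm_ge0.
have [/enorm_eq0 ->|v0] := eqVneq (enorm v) 0.
  by rewrite -(scale0r 0) dotZr mul0r mulr_ge0 ?enorm_ge0.
set p := enorm u; set q := enorm v.
have pq0 : 0 < p * q by rewrite mulr_gt0// lt0r ?u0 ?v0 enorm_ge0.
have := dot_ge0 (q *: u + (- p) *: v).
rewrite dotDr !dotZr ![dot (_ + _) _]dotC !dotDr !dotZr -!enorm_sqr -/p -/q.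
rewrite (dotC v u) => h.
have : 0 <= p * q * (p * q - dot u v) by nra.
by rewrite pmulr_rge0// subr_ge0.
Qed.

(** * Taylor estimate along a segment *)

Lemma rV_unitvec u : u = \sum_j u 0 j *: unitvec j.
Proof. exact: row_sum_delta. Qed.

Lemma derive_dot_grad (f : 'rV[R]_d -> R) t u :
  differentiable f t -> 'D_u f t = dot (grad f t) u.
Proof.
move=> ft; rewrite deriveE// {1}(rV_unitvec u) linear_sum.
by apply: eq_bigr => j _; rewrite linearZ /= mxE deriveE// mulrC.
Qed.

(** The difference quotient of s |-> f (t + s u) at s is literally the one that
    defines the derivative of f at t + s u in the direction u. *)
Lemma is_derive_line (f : 'rV[R]_d -> R) t u (s : R) :
  differentiable f (t + s *: u) ->
  is_derive s 1 (fun s => f (t + s *: u)) (dot (grad f (t + s *: u)) u).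
Proof.
move=> df; rewrite -derive_dot_grad//.
have quot : (fun h => h^-1 *: (((fun s => f (t + s *: u)) \o shift s) (h *: 1)
      - f (t + s *: u))) =
    (fun h => h^-1 *: ((f \o shift (t + s *: u)) (h *: u) - f (t + s *: u))).
  apply/funext => h /=.
  by rewrite [h *: 1]mulr1 scalerDl addrCA.
apply: DeriveDef; last by rewrite /derive quot.
by rewrite /derivable quot; exact: diff_derivable.
Qed.

(** The second derivative along a line is the quadratic form of the Hessian:
    each partial derivative of f is a coordinate of the gradient, hence is
    differentiable, and [is_derive_line] applies to it. *)
Lemma is_derive_slope (f : 'rV[R]_d -> R) t u (s : R) :
  differentiable (grad f) (t + s *: u) ->
  is_derive s 1 (fun s => dot (grad f (t + s *: u)) u)
    (dot ((hess f (t + s *: u) *m u^T)^T) u).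
Proof.
move=> dg; set t' := t + s *: u.
have dk k : differentiable ('D_(unitvec k) f) t'.
  have -> : 'D_(unitvec k) f = (fun N : 'rV[R]_d => N 0 k) \o grad f.
    by apply/funext => x /=; rewrite mxE.
  by apply: differentiable_comp => //; exact: differentiable_coord.
have -> : (fun s => dot (grad f (t + s *: u)) u) =
    \sum_k (u 0 k *: (fun s => 'D_(unitvec k) f (t + s *: u))).
  apply/funext => x; rewrite fct_sumE; apply: eq_bigr => k _.
  by rewrite mxE mulrC.
have h k := is_deriveZ (u 0 k) (is_derive_line (dk k)).
have hs := is_derive_sum h; apply: (is_derive_eq hs).
rewrite [RHS]/dot; under [RHS]eq_bigr do rewrite !mxE mulr_suml.
rewrite exchange_big/=; apply: eq_bigr => k _.
rewrite scaler_sumr; apply: eq_bigr => j _.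
by rewrite !mxE mulrAC [LHS]mulrC.
Qed.

(** Two applications of the mean value theorem, to f and then to its slope
    along the segment, produce a value of the quadratic form of the Hessian,
    which Cauchy-Schwarz bounds by C |u|^2.  The maximum with 0 covers
    dimension 0, where there is no unit vector to force C to be nonnegative. *)
Lemma descent_lemma (f : 'rV[R]_d -> R) (T : set 'rV[R]_d) (C : R) t u :
  C2_on T f ->
  (forall t v, T t -> enorm v = 1 -> enorm (hess f t *m v^T)^T <= C) ->
  (forall s : R, 0 <= s <= 1 -> T (t + s *: u)) ->
  f (t + u) <= f t + dot (grad f t) u + Num.max C 0 * enorm u ^+ 2.
Proof.
move=> [U [oU TU C2]] hC seg.
have segU (s : R) : s \in `[0, 1] -> U (t + s *: u).
  by rewrite in_itv => /seg /TU.
have d1 (s : R) : s \in `[0, 1] -> is_derive s 1 (fun s => f (t + s *: u))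
    (dot (grad f (t + s *: u)) u).
  by move=> /segU/C2[h _ _]; exact: is_derive_line.
have d2 (s : R) : s \in `[0, 1] -> is_derive s 1
    (fun s => dot (grad f (t + s *: u)) u)
    (dot ((hess f (t + s *: u) *m u^T)^T) u).
  by move=> /segU/C2[_ h _]; exact: is_derive_slope.
have oc (c : R) : c \in `]0, 1[ -> c \in `[0, 1] by exact: subset_itv_oo_cc.
have [|c c01] := @MVT _ _ _ 0 1 ltr01 (fun s h => d1 s (oc s h)).
  by apply: derivable_within_continuous => s /d1 [].
have {}c01 := oc _ c01; move: (c01); rewrite in_itv /= => /andP[c0 c1].
have in1 (s : R) : s \in `[0, c] -> s \in `[0, 1].
  by rewrite !in_itv /= => /andP[-> h] /=; exact: le_trans h c1.
rewrite scale1r scale0r addr0 subr0 mulr1 => e1.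
have [|e ec] := @MVT_segment _ _ _ 0 c c0
    (fun s h => d2 s (in1 s (subset_itv_oo_cc h))).
  by apply: derivable_within_continuous => s /in1/d2 [].
rewrite scale0r addr0 subr0 => e2.
have {ec}e01 := in1 _ ec.
(* The bound on unit vectors extends to all vectors by homogeneity. *)
have hess_bound v :
    enorm (hess f (t + e *: u) *m v^T)^T <= Num.max C 0 * enorm v.
  have [/enorm_eq0 ->|v0] := eqVneq (enorm v) 0.
    by rewrite trmx0 mulmx0 trmx0 enorm0 mulr0.
  have vp : 0 < enorm v by rewrite lt0r v0 enorm_ge0.
  rewrite -ler_pdivrMr// mulrC -[X in X * _]gtr0_norm ?invr_gt0// -enormZ.
  have -> A : (enorm v)^-1 *: (A *m v^T)^T = (A *m ((enorm v)^-1 *: v)^T)^T.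
    by rewrite [in RHS]linearZ /= -scalemxAr [in RHS]linearZ.
  rewrite le_max hC//.
    by apply: seg; rewrite in_itv /= in e01.
  by rewrite enormZ gtr0_norm ?invr_gt0// mulVf.
have q : dot ((hess f (t + e *: u) *m u^T)^T) u <= Num.max C 0 * enorm u ^+ 2.
  rewrite (le_trans (dot_le_enorm _ _))// expr2 mulrA.
  by rewrite ler_wpM2r ?enorm_ge0.
have M0 : 0 <= Num.max C 0 * enorm u ^+ 2.
  by rewrite mulr_ge0 ?sqr_ge0// le_max lexx orbT.
have qc := le_trans (ler_wpM2r c0 q) (ler_piMr M0 c1).
by move: e1 e2 qc => /=; lra.
Qed.
End euclidean_space.

(** * Measurability and almost sure events *)

Lemma continuous_enorm (R : realType) (d : nat) :
  continuous (@enorm R d).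
Proof.
move=> t; apply: continuous_comp; last exact: sqrt_continuous.
apply: differentiable_continuous.
have -> : (fun u : 'rV[R]_d => dot u u) =
    \sum_(j < d) ((fun u : 'rV[R]_d => u 0 j) * (fun u : 'rV[R]_d => u 0 j)).
  by apply/funext => u; rewrite fct_sumE.
apply: differentiable_sum => j.
by apply: differentiableM; exact: differentiable_coord.
Qed.

Section measurability.
Context {dO : measure_display} {O : measurableType dO} {R : realType}.

(** As f takes its values in U, the preimage of an open set V under g o f is
    the preimage under f of U `&` g^-1(V), which is open although g is
    arbitrary outside U. *)
Lemma measurable_continuous_on_comp (d : nat) (U : set 'rV[R]_d)
    (f : O -> borel_rV R d) (g : 'rV[R]_d -> R) :
  open U -> measurable_fun setT f -> (forall o, U (f o)) ->
  (forall t, U t -> {for t, continuous g}) ->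
  measurable_fun setT (fun o => g (f o)).
Proof.
move=> oU mf fU cg; apply: (measurability _ (RGenOpens.measurableE R)).
move=> _ [_ [a [b ->] <-]]; set V := (X in _ @^-1` X).
have -> : setT `&` (fun o => g (f o)) @^-1` V =
    setT `&` f @^-1` (U `&` g @^-1` V).
  by apply/seteqP; split=> o /= [_]; [move=> h; split|case].
apply: mf => //; apply: sub_sigma_algebra.
rewrite /= openE => t [Ut Vt]; apply: filterI.
  exact: open_nbhs_nbhs.
by apply: cg => //; apply: open_nbhs_nbhs; split=> //; exact: interval_open.
Qed.

Lemma measurable_trace_comp d1 d2 (T1 : measurableType d1)
    (T2 : measurableType d2) (D : set T1) (f : O -> T1) (g : T1 -> T2) :
  trace_measurable D g -> measurable_fun setT f -> (forall o, D (f o)) ->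
  measurable_fun setT (fun o => g (f o)).
Proof.
move=> mg mf fD _ B /mg[A mA DBA].
have -> : setT `&` (fun o => g (f o)) @^-1` B = setT `&` f @^-1` A.
  have e o : B (g (f o)) <-> A (f o).
    have : (D `&` g @^-1` B) (f o) <-> (D `&` A) (f o) by rewrite DBA.
    by move: (fD o); rewrite /=; tauto.
  by apply/seteqP; split=> o /= [_] /e.
exact: mf.
Qed.

(** A nonnegative sequence tends to 0 exactly when its limsup, a measurable
    function, is at most 0. *)
Lemma measurable_cvg0 (a : nat -> O -> R) :
  (forall n, measurable_fun setT (a n)) -> (forall n o, 0 <= a n o) ->
  measurable [set o | a n o @[n --> \oo] --> 0].
Proof.
move=> ma a0.
have := emeasurable_fun_infty_c measurableT
  (measurable_fun_limn_esup (fun n => (measurable_EFinP _ _).2 (ma n))) 0%E.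
congr measurable; rewrite setTI; apply/seteqP; split=> o /=.
  move=> h; apply: (@fine_cvg _ _ _ _ (fun n => (a n o)%:E) 0).
  by apply: limn_esup_le_cvg h _ => n; rewrite lee_fin.
move=> h.
have /cvg_limn_einf_sup[_ ->//] : (a n o)%:E @[n --> \oo] --> 0%:E.
by apply/cvg_EFin => //; exact: nearW.
Qed.

Lemma probability1_ae (P : probability O R) (Q : set O) :
  measurable Q -> {ae P, forall o, Q o} -> P Q = 1%E.
Proof.
move=> mQ /(negligibleP P (measurableC mQ)) PQ.
by rewrite -[Q]setCK probability_setC ?PQ ?sube0//; exact: measurableC.
Qed.

Lemma ae_probability1 (P : probability O R) (Q : set O) :
  measurable Q -> P Q = 1%E -> {ae P, forall o, Q o}.
Proof.
move=> mQ PQ; apply/(negligibleP P (measurableC mQ)).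
by have := probability_setC P mQ; rewrite PQ subee.
Qed.

End measurability.

(** * Bounded trajectories *)

Section paths.
Context {R : realType}.

(** Let A n be the sum of a and c up to n.  By induction W n stays below
    max (W 0, M + K) + S + A n: above the level M a step raises W by at
    most the increment of A, and a step started below M lands below M + K, while
    S + A n >= 0 for every n. *)
Lemma drift_bounded (W a b c : nat -> R) (M K S T : R) :
  (forall n, 0 <= c n) ->
  (forall n, M < W n -> W n.+1 <= W n + (a n + c n)) ->
  (forall n, W n <= M -> W n.+1 <= M + b n) ->
  (forall n, b n <= K) ->
  (forall n, `|\sum_(0 <= i < n) a i| <= S) ->
  (forall n, \sum_(0 <= i < n) c i <= T) ->
  forall n, W n <= Num.max (W 0%N) (M + K) + S + S + T.
Proof.
move=> c0 hi lo bK aS cT n; set B := Num.max _ _ + S.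
have cge0 m : 0 <= \sum_(0 <= i < m) c i by apply: sumr_ge0.
have inv m : W m <= B + (\sum_(0 <= i < m) a i + \sum_(0 <= i < m) c i).
  elim: m => [|m IH].
    rewrite !big_geq// !addr0.
    have := le_trans (normr_ge0 _) (aS 0%N).
    have : W 0%N <= Num.max (W 0%N) (M + K) by rewrite le_max lexx.
    by rewrite /B; lra.
  have [WM|WM] := leP (W m) M.
    have := lo _ WM; have := bK m; have := cge0 m.+1.
    have := aS m.+1; rewrite ler_norml => /andP[+ _].
    have : M + K <= Num.max (W 0%N) (M + K) by rewrite le_max lexx orbT.
    by rewrite /B; lra.
  by have := hi _ WM; rewrite !big_nat_recr//=; lra.
have := inv n; have := cT n; have := aS n; rewrite ler_norml => /andP[_].
by rewrite /B; lra.
Qed.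

Lemma limn_esup_bounded (W : nat -> R) (B : R) :
  (forall n, W n <= B) -> (limn_esup (fun n => (W n)%:E) < +oo)%E.
Proof.
move=> WB; apply: (@le_lt_trans _ _ B%:E); last exact: ltry.
rewrite limn_esup_lim; apply: lime_le; first exact: is_cvg_esups.
by apply: nearW => n; apply: ge_ereal_sup => _ [m _ <-]; rewrite lee_fin.
Qed.

End paths.

(** * Stability of the stochastic approximation *)

Theorem theorem2p5 (R : realType) (d : nat)
  (dX : measure_display) (X : measurableType dX)
  (dO : measure_display) (O : measurableType dO)
  (Theta : set 'rV[R]_d)
  (P : 'rV[R]_d -> R.-pker X ~> X)
  (pi : 'rV[R]_d -> probability X R)
  (H : 'rV[R]_d -> X -> 'rV[R]_d)
  (Rs : nat -> set 'rV[R]_d)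
  (Pr : 'rV[R]_d -> X -> probability O R)
  (Xp : 'rV[R]_d -> X -> nat -> O -> X)
  (Gam : 'rV[R]_d -> X -> nat -> O -> R)
  (th ths thp : 'rV[R]_d -> X -> nat -> O -> 'rV[R]_d)
  (w : 'rV[R]_d -> R) :
  stationary Theta P pi ->
  H_measurable Theta H ->
  H_integrable Theta pi H ->
  (forall i, Rs i `<=` Theta) ->
  (forall t x, Rs 0%N t ->
    sa_process P H (Pr t x) Rs
      (Xp t x) (Gam t x) (th t x) (ths t x) (thp t x) t x) ->
  (forall t x, Rs 0%N t -> moves_within Theta (Pr t x) (th t x) (ths t x)) ->
  lyapunov Theta pi H Pr Rs ths thp w ->
  (forall t x, Rs 0%N t ->
    [/\ noise1 H (Pr t x) (Xp t x) (Gam t x) (th t x) w,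
        noise2 H (Pr t x) (Xp t x) (Gam t x) (th t x) &
        noise3 pi H (Pr t x) (Xp t x) (Gam t x) (th t x) w]) ->
  forall t x, Rs 0%N t ->
    Pr t x [set o | (limn_esup (fun i => (w (th t x i o))%:E) < +oo)%E] = 1%E.
Proof.
move=> _ mH _ RsT sa mw ly noise t x t0.
have [n1 n2 n3] := noise t x t0.
have {}sa := sa t x t0; have {}mw := mw t x t0; move: mw sa n1 n2 n3.
have prj := lyap_proj ly x t0; move: prj.
move: (lyap_C2 ly) (lyap_hess ly) (lyap_drift ly) => C2w [Cw hCw]
  [M0 M0p drift] {ly}.
move: (Pr t x) (Xp t x) (Gam t x) (th t x) (ths t x) (thp t x) => {}Pr {}Xp
  {}Gam {}th {}ths {}thp prj mw sa n1 n2 n3 {noise}.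
have [U [oU TU C2U]] := C2w.
(* Projected or not, theta_i lies in R_i on every path. *)
have thRs i o : Rs i (th i o).
  case: i => [|i]; first by rewrite (sa_th0 sa).
  rewrite (sa_th sa); case: ifPn => [/set_mem//|_]; exact: (sa_thp_in sa).
have thT i o : Theta (th i o) by exact/RsT/thRs.
have thU i o : U (th i o) by exact/TU/thT.
have mwth i : measurable_fun setT (fun o => w (th i o)).
  apply: (measurable_continuous_on_comp oU) => [|//|u /C2U[wu _ _]].
    exact: (sa_th_meas sa).
  exact: differentiable_continuous.
have mgrad i : measurable_fun setT (fun o => enorm (grad w (th i o))).
  apply: (@measurable_continuous_on_comp _ _ _ _ U _ (fun u => enorm (grad w u)))
    => [//||//|u /C2U[_ gu _]]; first exact: (sa_th_meas sa).
  apply: (@continuous_comp _ _ _ (grad w) enorm).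
    exact: differentiable_continuous.
  exact: continuous_enorm.
have mHn i : measurable_fun setT (fun o => enorm (H (th i o) (Xp i.+1 o))).
  apply: (@measurable_continuous_on_comp _ _ _ _ setT
    (fun o => H (th i o) (Xp i.+1 o)) enorm) => [||//|u _].
  - exact: openT.
  - apply: (@measurable_trace_comp _ _ _ _ (borel_rV R d * X)%type
      (borel_rV R d) _ (fun o => (th i o, Xp i.+1 o)) _ mH) =>
      [|o]; last exact: thT.
    apply: measurable_fun_pair; first exact: (sa_th_meas sa).
    exact: (sa_X_meas sa).
  - exact: continuous_enorm.
apply: probability1_ae.
  have := emeasurable_fun_infty_o measurableT
    (measurable_fun_limn_esup (fun n => (measurable_EFinP _ _).2 (mwth n))) +oo%E.
  by rewrite setTI.
set b1 := fun i o => Gam i.+1 o * enorm (grad w (th i o))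
                        * enorm (H (th i o) (Xp i.+1 o)).
have {}n1 : {ae Pr, forall o, b1 i o @[i --> \oo] --> 0}.
  apply: ae_probability1 n1; apply: measurable_cvg0 => [i|i o].
    apply: measurable_funM => //; apply: measurable_funM => //.
    exact: (sa_Gam_meas sa).
  by rewrite !mulr_ge0 ?enorm_ge0// (sa_Gam_ge0 sa).
have {}n2 := integrable_ae measurableT n2.
have {}n3 := integrable_ae measurableT n3.
have {}mw := ae_foralln mw.
(* From here on the path is fixed. *)
near=> o; rewrite /=.
have b1_0 : b1 i o @[i --> \oo] --> 0 by near: o.
have seg i s : 0 <= s <= 1 -> Theta (th i o + s *: (ths i.+1 o - th i o)).
  by move: i s; near: o.
have proj i : (1 <= i)%N -> ~ Rs i (ths i o) ->
   Rs i (thp i o) /\ w (thp i o) <= w (ths i o).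
  by move: i; near: o.
have : (\sum_(0 <= i <oo)
      (Gam i.+1 o ^+ 2 * enorm (H (th i o) (Xp i.+1 o)) ^+ 2)%:E)%E \is a fin_num.
  by move: I; near: o.
have : ereal_sup (range (fun k : nat =>
      (`| \sum_(0 <= i < k.+1)
            Gam i.+1 o * dot (grad w (th i o)) (H_bar pi H (th i o) (Xp i.+1 o)) |
      )%:E)) \is a fin_num.
  by move: I; near: o.
pose a i :=
  Gam i.+1 o * dot (grad w (th i o)) (H_bar pi H (th i o) (Xp i.+1 o)).
pose q i := Gam i.+1 o ^+ 2 * enorm (H (th i o) (Xp i.+1 o)) ^+ 2.
set S := ereal_sup _; set T := (\sum_(_ <= _ <oo) _)%E.
move=> /fineK S_fin /fineK T_fin.
(* [noise3] bounds the sums with at least one term; the empty sum is 0. *)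
have aS n : `|\sum_(0 <= i < n) a i| <= fine S.
  have aS1 k : `|\sum_(0 <= i < k.+1) a i| <= fine S.
    by rewrite -lee_fin S_fin; apply: ereal_sup_ubound; exists k.
  by case: n => [|//]; rewrite big_geq// normr0 (le_trans _ (aS1 0%N)).
have q0 i : 0 <= q i by rewrite mulr_ge0 ?sqr_ge0.
have qT n : \sum_(0 <= i < n) q i <= fine T.
  rewrite -lee_fin T_fin -sumEFin; apply: nneseries_lim_ge => i _ _.
  by rewrite lee_fin.
have [K b1K] : exists K, forall i, b1 i o <= K.
  have /cvgP/cvg_seq_bounded/bounded_fun_has_ubound[K Kub] := b1_0.
  by exists K => i; apply: Kub; exists i.
set C := Num.max Cw 0.
have C0 : 0 <= C by rewrite le_max lexx orbT.
have inc i : ths i.+1 o - th i o = Gam i.+1 o *: H (th i o) (Xp i.+1 o).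
  by rewrite (sa_ths sa) addrC addKr.
have step i : w (th i.+1 o) <= w (th i o) +
    Gam i.+1 o * dot (grad w (th i o)) (H (th i o) (Xp i.+1 o)) + C * q i.
  have wths : w (th i.+1 o) <= w (ths i.+1 o).
    rewrite (sa_th sa); case: ifPn => // /negP nR.
    by have [] := proj i.+1 isT (fun h => nR (mem_set h)).
  apply: (le_trans wths).
  have := descent_lemma C2w hCw (seg i).
  by rewrite addrC subrK inc dotZr enormZ exprMn real_normK ?num_real.
apply: (@limn_esup_bounded _ _ (Num.max (w (th 0%N o)) (M0 + (K + C * fine T)) +
   fine S + fine S + C * fine T)).
have CT n : \sum_(0 <= i < n) (C * q i) <= C * fine T.
  by rewrite -mulr_sumr ler_wpM2l.
apply: (@drift_bounded _ _ a (fun i => b1 i o + C * q i) (fun i => C * q i)) =>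
  [i|i wM|i wM|i|//|//].
- exact: mulr_ge0.
- rewrite /= (le_trans (step i))// -addrA lerD2l lerD2r.
  rewrite ler_wpM2l ?(sa_Gam_ge0 sa)//.
  (* Above the level M0 the mean field points downhill. *)
  have -> : H (th i o) (Xp i.+1 o) =
      H_bar pi H (th i o) (Xp i.+1 o) + mean_field pi H (th i o).
    by rewrite /H_bar subrK.
  rewrite dotDr gerDl; apply: drift; split; last by exists i.
  by move=> [_]; rewrite leNgt wM.
- rewrite /= (le_trans (step i))// -addrA lerD// lerD2r.
  rewrite /b1 -mulrA ler_wpM2l ?(sa_Gam_ge0 sa)//.
  exact: dot_le_enorm.
- rewrite lerD// ler_wpM2l//.
  apply: le_trans (qT i.+1); rewrite big_nat_recr//= lerDr sumr_ge0//.
Unshelve. all: by end_near. Qed.
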